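(* Let $G$ be a graph and let $\Sigma$ be a discrete, crossing-finite, ECC separation system of $G$. Let $M_\Sigma$ be the median graph dual to $\Sigma$, and define $\beta:V(M_\Sigma)\to\mathcal P(V(G))$ by $$\beta(\mathcal U)=\bigcap_{(A,B)\in\mathcal U}A.$$ Then $(M_\Sigma,\beta)$ is a median decomposition of $G$.
   Context: Graphs are simple, undirected, possibly infinite. A separation of $G$ is an ordered pair $(A,B)$ of subsets of $V(G)$ with $A\cup B=V(G)$ and no edge joining $A\setminus B$ to $B\setminus A$. It is essential if $A\ne V(G)\neq B$. Its flip is $(A,B)^r=(B,A)$. Order: $(A,B)\le(C,D)$ iff $A\subseteq C$ and $D\subseteq B$. Two separations are nested if $(A,B)$ is comparable with $(C,D)$ or $(D,C)$; otherwise they cross. A separation system is a set $\Sigma$ of essential separations closed under flips. $\Sigma$ is discrete if $\{t\in\Sigma: s_1\le t\le s_2\}$ is finite for all $s_1,s_2\in\Sigma$; crossing-finite if every set of pairwise-crossing elements is finite; ECC if for every infinite strictly descending chain $(A_1,B_1)>(A_2,B_2)>\cdots$ in $\Sigma$, $\bigcap_n(A_n\setminus B_n)=\emptyset$. An ultrafilter on $\Sigma$ is a subset $\mathcal U\subseteq\Sigma$ such that for each $s\in\Sigma$ exactly one of $s,s^r$ lies in $\mathcal U$, and $s\in\mathcal U$, $s\le t\in\Sigma$ imply $t\in\mathcal U$. It is DCC if every descending chain in $\mathcal U$ is finite. The dual median graph $M_\Sigma$ has as vertices the DCC ultrafilters on $\Sigma$, with $\mathcal U,\mathcal V$ adjacent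 iff $|\mathcal U\triangle\mathcal V|=2$. The empty intersection is interpreted as $V(G)$. $I(u,v)$ is the set of vertices on some geodesic (shortest path) from $u$ to $v$. A median graph is a connected graph in which $I(u,v)\cap I(v,w)\cap I(w,u)$ is a single vertex for all vertices $u,v,w$. A subgraph $C$ is convex if every geodesic with endpoints in $C$ is contained in $C$. A median decomposition of $G$ is a pair $(M,\beta)$ with $M$ a median graph and $\beta:V(M)\to\mathcal P(V(G))$ such that (M1) $\bigcup_u\beta(u)=V(G)$; (M2) every edge of $G$ has both ends in some $\beta(u)$; (M3) for every $v\in V(G)$ the set $\beta^{-1}(v)=\{u: v\in\beta(u)\}$ induces a convex subgraph of $M$. *)

(* Defs.v *)
From Stdlib Require List.
From mathcomp Require Import all_boot.
From mathcomp Require Import boolp classical_sets functions cardinality.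

Set Implicit Arguments.
Unset Strict Implicit.
Unset Printing Implicit Defensive.

Local Open Scope classical_set_scope.
Local Open Scope card_scope.

Record sgraph := SGraph {
  vertex :> Type;
  adj : rel vertex;
  adj_sym : symmetric adj;
  adj_irrefl : irreflexive adj }.

Section Graphs.
Variable G : sgraph.
Implicit Types (u v w x : G) (p : seq G) (C : set G).

(* The walk u :: p from u to v, of length size p. *)
Definition walk u v p := path (@adj G) u p /\ last u p = v.

(* A walk of minimum length repeats no vertex, so geodesics are exactly the
   shortest paths. *)
Definition geodesic u v p :=
  walk u v p /\ forall q, walk u v q -> (size p <= size q)%N.

Definition interval u v : set G :=
  [set x | exists2 p, geodesic u v p & List.In x (u :: p)].

Definition connected_graph :=
  (exists u : G, True) /\ forall u v, exists p, walk u v p.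

Definition median_graph :=
  connected_graph /\
  forall u v w, exists x,
    interval u v `&` interval v w `&` interval w u = [set x].

(* The subgraph induced by C contains a walk as soon as it contains its
   vertices. *)
Definition induces_convex C :=
  forall u v p, C u -> C v -> geodesic u v p ->
    forall x, List.In x (u :: p) -> C x.

End Graphs.

Definition median_decomposition (G M : sgraph) (beta : M -> set G) :=
  [/\ median_graph M,
      \bigcup_u beta u = [set: G],
      forall x y : G, adj x y -> exists u, beta u x /\ beta u y
    & forall v : G, induces_convex [set u | beta u v]].

Section Separations.
Variable G : sgraph.

Definition sep : Type := (set G * set G)%type.

Implicit Types (s t : sep) (Sigma U : set sep).

Definition is_separation s :=
  s.1 `|` s.2 = [set: G] /\
  forall x y, (s.1 `\` s.2) x -> (s.2 `\` s.1) y -> ~~ adj x y.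

Definition essential s := s.1 <> [set: G] /\ s.2 <> [set: G].

Definition flip s : sep := (s.2, s.1).

Definition sep_le s t := s.1 `<=` t.1 /\ t.2 `<=` s.2.

Definition sep_lt s t := sep_le s t /\ s <> t.

Definition sep_comparable s t := sep_le s t \/ sep_le t s.

Definition nested s t := sep_comparable s t \/ sep_comparable s (flip t).

Definition crossing s t := ~ nested s t.

Definition separation_system Sigma :=
  (forall s, Sigma s -> is_separation s /\ essential s) /\
  (forall s, Sigma s -> Sigma (flip s)).

Definition discrete Sigma :=
  forall s1 s2, Sigma s1 -> Sigma s2 ->
    finite_set [set t | [/\ Sigma t, sep_le s1 t & sep_le t s2]].

Definition crossing_finite Sigma :=
  forall C, C `<=` Sigma ->
    (forall s t, C s -> C t -> s <> t -> crossing s t) -> finite_set C.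

Definition strictly_descending (f : nat -> sep) :=
  forall n, sep_lt (f n.+1) (f n).

Definition ECC Sigma :=
  forall f : nat -> sep, (forall n, Sigma (f n)) -> strictly_descending f ->
    \bigcap_n ((f n).1 `\` (f n).2) = set0.

Definition ultrafilter Sigma U :=
  [/\ U `<=` Sigma,
      forall s, Sigma s -> (U s \/ U (flip s)) /\ ~ (U s /\ U (flip s))
    & forall s t, U s -> Sigma t -> sep_le s t -> U t].

Definition DCC U :=
  ~ exists f : nat -> sep, (forall n, U (f n)) /\ strictly_descending f.

Definition dcc_ultrafilter Sigma : Type :=
  {U : set sep | ultrafilter Sigma U /\ DCC U}.

Section Dual.
Variable Sigma : set sep.

Definition dual_adj : rel (dcc_ultrafilter Sigma) :=
  fun U V : dcc_ultrafilter Sigma => (proj1_sig U `+` proj1_sig V) #= `I_2.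

Lemma dual_adj_sym : symmetric dual_adj.
Proof. by move=> U V; rewrite /dual_adj setYC. Qed.

Lemma dual_adj_irrefl : irreflexive dual_adj.
Proof.
move=> U; rewrite /dual_adj setYK card_eq_sym card_eq0.
by apply/negP => /eqP I20; have : `I_2 0%N by []; rewrite I20.
Qed.

Definition dual_graph : sgraph := SGraph dual_adj_sym dual_adj_irrefl.

(* \bigcap over the empty family is setT, i.e. V(G). *)
Definition dual_part (U : dual_graph) : set G :=
  \bigcap_(s in proj1_sig U) s.1.

End Dual.
End Separations.

(* Main.v *)
(* If U and V are DCC ultrafilters, the elements of U \ V are nested only when
   comparable, so finiteness of crossing families and discreteness make U \ V
   finite.  Flipping minimal elements of U \ V one at a time joins U to V, whence
   d(U, V) = #|U \ V| and W lies between U and V iff U `&` V `<=` W.  The median of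
   three ultrafilters is then their majority, and (M3) is immediate.  For (M1) and
   (M2), orient every separation towards a given vertex or edge; ECC handles the
   forced orientations, and a maximal crossing family decides the others. *)
Require Import Defs.
From mathcomp Require Import all_boot finmap.
From mathcomp Require Import boolp classical_sets functions cardinality.

Set Implicit Arguments.
Unset Strict Implicit.
Unset Printing Implicit Defensive.

Local Open Scope classical_set_scope.
Local Open Scope card_scope.

(** * The order on separations, flips and descending chains *)

Section SeparationOrder.
Variable G : sgraph.
Implicit Types (s t r : sep G) (Sigma U V W C : set (sep G)).

Lemma flipK : involutive (@flip G).
Proof. by case. Qed.

Lemma sep_le_refl s : sep_le s s.
Proof. by split. Qed.

Lemma sep_le_trans s t r : sep_le s t -> sep_le t r -> sep_le s r.
Proof.
move=> [st1 st2] [tr1 tr2]; split.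
  exact: subset_trans tr1.
exact: subset_trans st2.
Qed.

Lemma sep_le_anti s t : sep_le s t -> sep_le t s -> s = t.
Proof.
case: s t => [A B] [C D] [/= AC DB] [/= CA BD].
by congr pair; apply/seteqP.
Qed.

Lemma sep_le_flip s t : sep_le s t -> sep_le (flip t) (flip s).
Proof. by move=> []. Qed.

Lemma sep_le_flipl s t : sep_le (flip s) t -> sep_le (flip t) s.
Proof. by move=> []. Qed.

Lemma sep_le_flipr s t : sep_le s (flip t) -> sep_le t (flip s).
Proof. by move=> []. Qed.

Lemma sep_lt_le_trans s t r : sep_lt s t -> sep_le t r -> sep_lt s r.
Proof.
move=> [st nst] tr; split; first exact: sep_le_trans tr.
by move=> sr; apply: nst; apply: sep_le_anti => //; rewrite sr.
Qed.

(** If [s.1] were contained in [s.2], then [s.2] would equal the union of the two sides, which is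
    all of [G]; essentiality forbids this. *)
Lemma separation_systemN_le_flip Sigma s :
  separation_system Sigma -> Sigma s -> ~ sep_le s (flip s).
Proof.
move=> [sepS _] /sepS [[s12 _] [_ s2]] [/= le12 _]; apply: s2.
by rewrite -s12; apply/esym/setUidPr.
Qed.

Lemma separation_systemN_flip_le Sigma s :
  separation_system Sigma -> Sigma s -> ~ sep_le (flip s) s.
Proof.
move=> SS Ss le; apply: (separation_systemN_le_flip SS (SS.2 _ Ss)).
by rewrite flipK.
Qed.

Lemma crossing_sym s t : crossing s t -> crossing t s.
Proof.
move=> cst [[]|[]] le; apply: cst.
- by left; right.
- by left; left.
- by right; left; apply: sep_le_flipr.
- by right; right; apply: sep_le_flipl.
Qed.

Lemma descending_le (f : nat -> sep G) m n :
  strictly_descending f -> (m <= n)%N -> sep_le (f n) (f m).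
Proof.
move=> df /subnK <-; elim: (n - m)%N => [|k IH]; first exact: sep_le_refl.
by rewrite addSn; apply: sep_le_trans IH; case: (df (k + m)%N).
Qed.

Lemma descending_inj (f : nat -> sep G) : strictly_descending f -> injective f.
Proof.
move=> df; suff lt m n : (m < n)%N -> f m <> f n.
  by move=> m n; case: (ltngtP m n) => // /lt ne // /esym.
move=> mn e; have [le ne] := df m; apply: ne; apply: sep_le_anti => //.
by rewrite e; apply: descending_le.
Qed.

Lemma descending_infinite (f : nat -> sep G) U :
  strictly_descending f -> (forall n, U (f n)) -> ~ finite_set U.
Proof.
move=> df Uf finU; apply: infinite_nat.
have -> : [set: nat] = f @^-1` U by apply/seteqP; split=> // n _; apply: Uf.
by apply: finite_preimage => // m n _ _; apply: descending_inj.
Qed.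

(** Without such an [m], choice yields a function that maps each member of [U] below [s] to a
    strictly smaller one, and its iterates from [s] form an infinite descending chain. *)
Lemma DCC_min U s : DCC U -> U s ->
  exists m, [/\ U m, sep_le m s & forall t, U t -> sep_le t m -> t = m].
Proof.
move=> dU Us; apply: contrapT => nomin; apply: dU.
have step (t : sep G) : exists t', U t -> sep_le t s -> U t' /\ sep_lt t' t.
  have [[Ut ts]|nt] := pselect (U t /\ sep_le t s); last first.
    by exists t => Ut ts; case: nt.
  apply: contrapT => nt; apply: nomin; exists t; split=> // r Ur rt.
  by apply: contrapT => ne; apply: nt; exists r => _ _; split=> //; split.
have [g gP] := choice step.
pose f n := iter n g s.
have fP n : U (f n) /\ sep_le (f n) s.
  elim: n => [|n [Ufn fns]]; first by split=> //; apply: sep_le_refl.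
  have [? [le _]] := gP _ Ufn fns.
  by split=> //; apply: sep_le_trans le fns.
by exists f; split=> n; have [? ?] := fP n => //; have [] := gP (f n).
Qed.

Lemma DCC_sub U V : U `<=` V -> DCC V -> DCC U.
Proof. by move=> UV dV [f [Uf df]]; apply: dV; exists f; split=> // n; apply: UV. Qed.

End SeparationOrder.

(** * Existence of DCC ultrafilters *)

Section Orientation.
Variables (G : sgraph) (Sigma : set (sep G)).
Hypothesis SS : separation_system Sigma.
Implicit Types (s t r : sep G) (U V W C : set (sep G)).

Let crossing_family C :=
  C `<=` Sigma /\ forall s t, C s -> C t -> s <> t -> crossing s t.

(** Zorn's lemma applies because any two members of the union of a chain of families already lie in
    a common one. The second clause is used in contrapositive form: a separation outside [C] is
    nested with some member of [C]. *)
Let maximal_crossing_family :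
  exists2 C, crossing_family C &
    forall s, Sigma s -> (forall t, C t -> crossing t s) -> C s.
Proof.
have [|C [[CS Ccr] Cmax]] := @Zorn_bigcup (sep G) crossing_family.
  move=> F FC Ftot; split.
    by move=> s [X /FC [XS _] /XS].
  move=> s t [X FX Xs] [Y FY Yt].
  have [XY|YX] := Ftot _ _ FX FY.
    by have [_] := FC _ FY; apply=> //; apply: XY.
  by have [_] := FC _ FX; apply=> //; apply: YX.
exists C => // s Ss sC; apply: contrapT => nCs.
apply: (Cmax (C `|` [set s])).
  split; first by move=> t; left.
  by move=> CsC; apply: nCs; apply: CsC; right.
split; first by move=> t [/CS//|->].
move=> t r [Ct|->] [Cr|->] tr.
- exact: Ccr.
- exact: sC.
- exact/crossing_sym/sC.
- by case: tr.
Qed.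

(* The orientation selects a maximal crossing family C, which is finite, and
   everything strictly above an element of C or of its flip: a descending chain
   then starts and stays in finitely many order intervals. *)
Lemma exists_dcc_ultrafilter :
  discrete Sigma -> crossing_finite Sigma ->
  exists U, ultrafilter Sigma U /\ DCC U.
Proof.
move=> dS cS; have [C [CS Ccr] Cmax] := maximal_crossing_family.
have SF s : Sigma s -> Sigma (flip s) by apply: SS.2.
pose E := C `|` @flip G @` C.
have ES : E `<=` Sigma by move=> s [/CS//|[t /CS /SF ? <-]].
have EF s : E s -> E (flip s).
  by move=> [Cs|[t Ct <-]]; [right; exists s | left; rewrite flipK].
(* [E] is an antichain: nested members of [C] coincide, and a separation is never comparable with
   its own flip. *)
have Enest a b : E a -> E b -> sep_le a b -> a = b.
  have cr c d : C c -> C d -> nested c d -> c = d.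
    by move=> Cc Cd ncd; apply: contrapT => /(Ccr _ _ Cc Cd).
  have nlef c : C c -> ~ sep_le c (flip c).
    by move=> /CS; apply: separation_systemN_le_flip.
  have nfle c : C c -> ~ sep_le (flip c) c.
    by move=> /CS; apply: separation_systemN_flip_le.
  move=> [Ca|[c Cc <-]] [Cb|[d Cd <-]] le.
  - by apply: cr => //; left; left.
  - have e : a = d by apply: cr => //; right; left.
    by move: le; rewrite e => /nlef -/(_ Cd).
  - have e : c = b by apply: cr => //; right; right; apply: sep_le_flipl.
    by move: le; rewrite e => /nfle -/(_ Cb).
  - congr flip; apply: cr => //; left; right.
    by have := sep_le_flip le; rewrite !flipK.
pose U := C `|` [set t | Sigma t /\ exists2 a, E a & sep_lt a t].
have U_above t : U t -> exists2 a, E a & sep_le a t.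
  move=> [Ct|[_ [a Ea [at_ _]]]]; last by exists a.
  by exists t; [left | apply: sep_le_refl].
have US : U `<=` Sigma by move=> t [/CS//|[]].
exists U; split; last first.
  move=> [f [Uf df]].
  apply: (@descending_infinite _ f
    (\bigcup_(a in E) [set t | [/\ Sigma t, sep_le a t & sep_le t (f 0%N)]])) => //.
    move=> n; have [a Ea le] := U_above _ (Uf n).
    by exists a => //; split; [apply: US | | apply: descending_le].
  apply: bigcup_finite.
    rewrite finite_setU; have finC : finite_set C by apply: cS.
    by split=> //; apply: finite_image.
  by move=> a Ea; apply: dS; [apply: ES | apply: US].
split=> //.
- move=> s Ss; split.
    have [Es|nEs] := pselect (E s).
      case: Es => [Cs|[c Cc <-]]; first by left; left.
      by right; left; rewrite flipK.
    (* Given such a [c], each of the four ways of being nested puts [s] or [flip s] strictly above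
       [c] or [flip c], hence in [U]. *)
    suff [c [Cc ncs]] : exists c, C c /\ nested c s.
      have cs : c <> s by move=> e; apply: nEs; left; rewrite -e.
      have fcs : c <> flip s by move=> e; apply: nEs; right; exists c; rewrite // e flipK.
      have Ec : E c by left.
      have Efc := EF _ Ec.
      have ne x y : x <> flip y -> flip x <> y by move=> h e; apply: h; rewrite -e flipK.
      case: ncs => [[le|le]|[le|le]].
      + by left; right; split=> //; exists c.
      + right; right; split; first exact: SF.
        exists (flip c) => //; split; first exact: sep_le_flip.
        by move=> /(congr1 (@flip G)); rewrite !flipK.
      + right; right; split; first exact: SF.
        by exists c.
      + left; right; split=> //.
        exists (flip c) => //; split; first exact: sep_le_flipl.
        exact: ne.
    apply: contrapT => noc; apply: nEs; left; apply: Cmax => // t Ct nts.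
    by apply: noc; exists t.
  have nCU c : C c -> ~ U (flip c).
    move=> Cc [Cfc|[_ [a Ea [le ne]]]].
      have Ec : E c by left.
      have : sep_le c (flip c).
        have e : c = flip c.
          apply: contrapT => ne; apply: (Ccr _ _ Cc Cfc ne).
          by right; left; rewrite flipK; apply: sep_le_refl.
        by rewrite -e; apply: sep_le_refl.
      exact: separation_systemN_le_flip (CS _ Cc).
    by apply: ne; apply: Enest => //; right; exists c.
  move=> [[Cs|[_ [a Ea [as_ nas]]]] Ufs]; first exact: nCU Ufs.
  case: Ufs => [Cfs|[_ [b Eb [bs nbs]]]].
    by apply: (nCU _ Cfs); rewrite flipK; right; split=> //; exists a.
  (* If both [s] and [flip s] were selected from above, by [a] and [b], then [a < s <= flip b] would
     relate two distinct members of the antichain [E]. *)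
  have lt : sep_lt a (flip b).
    by apply: (sep_lt_le_trans (t := s)) => //; apply: sep_le_flipr.
  by apply: lt.2; apply: Enest => //; [apply: EF | exact: lt.1].
- move=> s t [Cs|[Ss [a Ea as_]]] St st; last first.
    by right; split=> //; exists a => //; apply: sep_lt_le_trans st.
  have [<-|ne] := pselect (s = t); first by left.
  by right; split=> //; exists s; [left | split].
Qed.

End Orientation.

(* ECC makes the separations whose big side is forced by {x, y} satisfy DCC; those
   with both x and y in their separator form a system of their own, and no forced
   separation lies below one of these. *)
Lemma exists_dcc_ultrafilter_containing (G : sgraph) (Sigma : set (sep G)) (x y : G) :
  separation_system Sigma -> discrete Sigma -> crossing_finite Sigma ->
  ECC Sigma ->
  (forall s, Sigma s -> (s.1 x /\ s.1 y) \/ (s.2 x /\ s.2 y)) ->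
  exists U : dual_graph Sigma, dual_part U x /\ dual_part U y.
Proof.
move=> SS dS cS ecc sided.
pose both (A : set G) := A x /\ A y.
pose S0 := [set s | [/\ Sigma s, both s.1 & both s.2]].
pose F := [set s | [/\ Sigma s, both s.1 & ~ both s.2]].
have S0S : S0 `<=` Sigma by move=> s [].
have SS0 : separation_system S0.
  split; first by move=> s /S0S /SS.1.
  by move=> s [/SS.2 Ss s1 s2]; split.
have dS0 : discrete S0.
  move=> s t /S0S Ss /S0S St; apply: sub_finite_set (dS _ _ Ss St).
  by move=> r [/S0S].
have cS0 : crossing_finite S0.
  by move=> C CS0; apply: cS; apply: subset_trans S0S.
have [U [[US0 U1 Uup] dU]] := exists_dcc_ultrafilter SS0 dS0 cS0.
have both_le A B : A `<=` B -> both A -> both B by move=> AB [? ?]; split; apply: AB.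
have dF : DCC F.
  move=> [f [Ff df]].
  (* By ECC no vertex stays in the strict first side forever. Second sides grow along the chain, so
     once [x] and [y] have both entered, the term is no longer in [F]. *)
  have hits z : (forall n, (f n).1 z) -> exists n, (f n).2 z.
    move=> f1; apply: contrapT => nf2.
    have : (\bigcap_n ((f n).1 `\` (f n).2)) z.
      by move=> n _; split=> // f2; apply: nf2; exists n.
    by rewrite ecc // => n; have [] := Ff n.
  have [m mx] : exists n, (f n).2 x by apply: hits => n; have [_ []] := Ff n.
  have [n ny] : exists n, (f n).2 y by apply: hits => k; have [_ []] := Ff k.
  have [_ _ nb] := Ff (maxn m n); apply: nb; split.
    exact: (descending_le df (leq_maxl m n)).2.
  exact: (descending_le df (leq_maxr m n)).2.
have uT : ultrafilter Sigma (F `|` U).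
  split.
  - by move=> s [[]|/US0/S0S].
  - move=> s Ss; have Sfs := SS.2 _ Ss.
    have [b1|nb1] := pselect (both s.1); have [b2|nb2] := pselect (both s.2).
    + have [[Us|Ufs] nU] : (U s \/ U (flip s)) /\ ~ (U s /\ U (flip s)) by apply: U1.
        split; first by left; right.
        by move=> [[[]//|_] [[]//|?]]; apply: nU.
      split; first by right; right.
      by move=> [[[]//|?] [[]//|_]]; apply: nU.
    + split; first by left; left.
      by move=> [_ [[]//|/US0 []]].
    + split; first by right; left.
      by move=> [[[]//|/US0 []]].
    + by case: (sided _ Ss).
  - move=> s t FUs St st.
    have b1 : both s.1 by case: FUs => [[]|/US0 []].
    have [b2|nb2] := pselect (both t.2); last first.
      by left; split=> //; apply: both_le b1; exact: st.1.
    case: FUs => [[_ _ []]|Us]; first by apply: both_le b2; exact: st.2.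
    right; apply: (Uup s) => //; split=> //.
    by apply: both_le b1; exact: st.1.
have dT : DCC (F `|` U).
  move=> [f [FUf df]].
  (* A chain either stays in [F] or enters [U]; from then on its second sides contain both [x] and
     [y], so it cannot return to [F]. *)
  have [[n Ufn]|nU] := pselect (exists n, U (f n)); last first.
    apply: dF; exists f; split=> // n.
    by case: (FUf n) => // Ufn; case: nU; exists n.
  apply: dU; exists (fun k => f (k + n)%N); split; last by move=> k; apply: df.
  move=> k; case: (FUf (k + n)%N) => // -[_ _ []].
  have [_ _ b2] := US0 _ Ufn; apply: both_le b2.
  exact: (descending_le df (leq_addl k n)).2.
exists (exist _ (F `|` U) (conj uT dT)).
have b1 s : (F `|` U) s -> both s.1 by move=> [[]|/US0 []].
by split=> s /b1 [].
Qed.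

Lemma walk_split (G : sgraph) (u v w : G) (p : seq G) :
  walk u v p -> List.In w (u :: p) ->
  exists p1 p2, [/\ p = p1 ++ p2, walk u w p1 & walk w v p2].
Proof.
elim: p u => [|a p IH] u [pp lp].
  by move=> [uw|//]; exists [::], [::]; rewrite -uw.
move=> [uw|wp]; first by exists [::], (a :: p); rewrite -uw.
have /andP [ua pa] : adj u a && path (@adj G) a p := pp.
have [//|p1 [p2 [-> [pp1 lp1] w2]]] := IH a _ wp.
by exists (a :: p1), p2; split=> //; split=> //=; rewrite ua.
Qed.

(** * Differences of DCC ultrafilters and adjacency in the dual graph *)

Section DualGraph.
Variables (G : sgraph) (Sigma : set (sep G)).
Hypotheses (SS : separation_system Sigma) (dS : discrete Sigma).
Hypothesis cS : crossing_finite Sigma.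
Implicit Types (s t r : sep G).
Notation M := (dual_graph Sigma).
Implicit Types (U V W : M) (p : seq M).

Local Coercion uset (U : M) : set (sep G) := proj1_sig U.

Lemma uset_inj U V : uset U = uset V -> U = V.
Proof. by case: U V => [U uU] [V uV]; rewrite /uset /= => e; apply: eq_exist. Qed.

Lemma uset_sub U s : uset U s -> Sigma s.
Proof. by have [[US _ _] _] := proj2_sig U; apply: US. Qed.

Lemma uset_flip U s : uset U s -> ~ uset U (flip s).
Proof.
have [[US U1 _] _] := proj2_sig U => Us Ufs.
by have [_ nU] := U1 _ (US _ Us); apply: nU.
Qed.

Lemma uset_or U s : Sigma s -> uset U s \/ uset U (flip s).
Proof. by have [[_ U1 _] _] := proj2_sig U => /U1 []. Qed.

Lemma usetN U s : Sigma s -> ~ uset U s -> uset U (flip s).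
Proof. by move=> /(uset_or U) []. Qed.

Lemma uset_flipN U s : Sigma s -> ~ uset U (flip s) -> uset U s.
Proof. by move=> /(uset_or U) []. Qed.

Lemma uset_up U s t : uset U s -> Sigma t -> sep_le s t -> uset U t.
Proof. by have [[_ _ Uup] _] := proj2_sig U; apply: Uup. Qed.

Lemma uset_DCC U : DCC (uset U).
Proof. by have [] := proj2_sig U. Qed.

Lemma flip_setD U V s : (uset U `\` uset V) s -> (uset V `\` uset U) (flip s).
Proof.
by move=> [Us nVs]; split; [apply: usetN => //; apply: uset_sub Us | apply: uset_flip].
Qed.

(** Each ultrafilter picks exactly one separation from every flip pair, so neither can be strictly
    larger. *)
Lemma uset_sub_eq U V : uset U `<=` uset V -> U = V.
Proof.
move=> UV; apply: uset_inj; apply/seteqP; split=> // s Vs.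
apply: uset_flipN (uset_sub Vs) _ => /UV.
exact: uset_flip.
Qed.

(** The two remaining ways of being nested are excluded by upward closure: [s <= flip t] would put
    [flip t] in [U], and [flip t <= s] would put [s] in [V]. *)
Lemma setD_crossing U V s t :
  (uset U `\` uset V) s -> (uset U `\` uset V) t -> ~ sep_le s t -> ~ sep_le t s ->
  crossing s t.
Proof.
move=> Ds Dt nst nts [[]|[]] // le.
  have Sft := SS.2 _ (uset_sub Dt.1).
  exact: (uset_flip Dt.1 (uset_up Ds.1 Sft le)).
have [Vft _] := flip_setD Dt.
by apply: Ds.2; apply: (uset_up Vft) => //; apply: uset_sub Ds.1.
Qed.

Lemma finite_setD_min U V : finite_set
  [set m | (uset U `\` uset V) m /\ forall t, (uset U `\` uset V) t -> sep_le t m -> t = m].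
Proof.
apply: cS => [s [[/uset_sub Ss _] _] //|s t [Ds mins] [Dt mint] ne].
apply: (setD_crossing Ds Dt) => le; apply: ne.
  exact: mint.
exact/esym/mins.
Qed.

(* Flipping exchanges U \ V and V \ U, so every element of U \ V lies between one
   of its minimal elements and one of its maximal elements; both kinds are pairwise
   crossing, hence finite in number. *)
Lemma finite_setD U V : finite_set (uset U `\` uset V).
Proof.
pose mn U V := [set m | (uset U `\` uset V) m /\
  forall t, (uset U `\` uset V) t -> sep_le t m -> t = m].
apply: (@sub_finite_set _ _ (\bigcup_(m in mn U V) \bigcup_(k in mn V U)
  [set t | [/\ Sigma t, sep_le m t & sep_le t (flip k)]])).
  move=> s Ds.
  have DDCC W W' : DCC (uset W `\` uset W').
    by apply: DCC_sub (@uset_DCC W) => t [].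
  have [m [Dm ms mmin]] := DCC_min (DDCC U V) Ds.
  have [k [Dk ks kmin]] := DCC_min (DDCC V U) (flip_setD Ds).
  exists m => //; exists k => //; split=> //; first exact: uset_sub Ds.1.
  exact: sep_le_flipr.
apply: bigcup_finite; first exact: finite_setD_min.
move=> m [[/uset_sub Sm _] _]; apply: bigcup_finite; first exact: finite_setD_min.
by move=> k [[/uset_sub /SS.2 Sk _] _]; apply: dS.
Qed.

(** Flipping matches the two halves of the symmetric difference, so it has two elements exactly when
    each half has one. *)
Lemma dual_adjP U V : @adj M U V <-> exists s, uset U `\` uset V = [set s].
Proof.
rewrite /= /dual_adj -/(uset U) -/(uset V); split; last first.
  move=> [s Ds]; have [Us nVs] : (uset U `\` uset V) s by rewrite Ds.
  have [Vfs nUfs] := flip_setD (conj Us nVs).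
  have ne : s <> flip s by move=> e; apply: nUfs; rewrite -e.
  apply/eq_cardSP; exists s; first by left.
  suff -> : (uset U `+` uset V) `\ s = [set flip s] by rewrite card_set1.
  apply/seteqP; split=> t; last first.
    by move=> ->; split; [right | move=> e; apply: ne].
  move=> [[Dt|/flip_setD Dt] /= nts].
    by have : [set s] t by rewrite -Ds.
  have : [set s] (flip t) by rewrite -Ds.
  by move=> /= <-; rewrite flipK.
move=> /eq_cardSP [a Da /eq_cardSP [b Db]].
rewrite II0 card_eq0 => /eqP ab0.
have inab t : (uset U `+` uset V) t -> t = a \/ t = b.
  move=> Dt; apply: contrapT => nab.
  suff: (set0 : set (sep G)) t by [].
  by rewrite -ab0; split; [split|] => // e; apply: nab; [left|right].
have [s Ds] : exists s, (uset U `\` uset V) s.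
  by case: Da => [|/flip_setD] Da; [exists a | exists (flip a)].
exists s; apply/seteqP; split=> [t Dt|t -> //].
(* All of [s], [t] and [flip s] lie in [{a, b}], and [flip s] differs from the other two, so
   [t = s]. *)
have Dfs := flip_setD Ds.
have sfs : s <> flip s by move=> e; apply: Dfs.2; rewrite -e; exact: Ds.1.
have tfs : t <> flip s by move=> e; apply: Dfs.2; rewrite -e; exact: Dt.1.
have := inab _ (or_introl Ds); have := inab _ (or_introl Dt).
have := inab _ (or_intror Dfs).
by move=> [] e1 [] e2 [] e3; move: sfs tfs; rewrite /= e1 e2 e3.
Qed.

(** * Distances, geodesics and intervals in the dual graph *)

(** This turns out to be the graph distance. As [fset_set] sends infinite sets to the empty one, the
    count relies on [finite_setD] for its meaning. *)
Definition cut_count U V := #|` fset_set (uset U `\` uset V)|%fset.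

Lemma cut_countS U V s (D := uset U `\` uset V) :
  D s -> cut_count U V = #|` fset_set (D `\ s)|%fset.+1.
Proof.
move=> Ds; have finD : finite_set D by apply: finite_setD.
rewrite /cut_count -/D fset_setD1 // (cardfsD1 s (fset_set D)).
by rewrite in_fset_set // mem_set.
Qed.

Lemma cut_count_triangle U W V :
  (cut_count U V <= cut_count U W + cut_count W V)%N.
Proof.
have sub : uset U `\` uset V `<=` (uset U `\` uset W) `|` (uset W `\` uset V).
  by move=> s [Us nVs]; have [Ws|nWs] := pselect (uset W s); [right | left].
have finU : finite_set ((uset U `\` uset W) `|` (uset W `\` uset V)).
  by rewrite finite_setU; split; apply: finite_setD.
rewrite (fset_set_sub (finite_setD U V) finU) in sub.
apply: leq_trans (fsubset_leq_card sub) _.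
rewrite fset_setU; [|exact: finite_setD..].
exact: leq_card_fsetU.
Qed.

(** The disjoint sets [A] and [B] cover the difference of [U] and [V], so the counts add up exactly
    when their union is no larger than that difference. *)
Lemma cut_count_add U W V :
  (cut_count U V == cut_count U W + cut_count W V)%N <->
  uset U `&` uset V `<=` uset W.
Proof.
set A := uset U `\` uset W; set B := uset W `\` uset V.
have finA : finite_set A by apply: finite_setD.
have finB : finite_set B by apply: finite_setD.
have finAB : finite_set (A `|` B) by rewrite finite_setU.
have finD : finite_set (uset U `\` uset V) by apply: finite_setD.
have sub : uset U `\` uset V `<=` A `|` B.
  by move=> s [Us nVs]; have [Ws|nWs] := pselect (uset W s); [right | left].
have cAB : #|` fset_set (A `|` B)|%fset = (cut_count U W + cut_count W V)%N.
  rewrite fset_setU // cardfsU -fset_setI //.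
  suff -> : A `&` B = set0 by rewrite fset_set0 cardfs0 subn0.
  by apply/seteqP; split=> // s [[_ nW] [Ws]].
rewrite -cAB; split.
  rewrite (fset_set_sub finD finAB) in sub.
  rewrite (fsubset_leqif_cards sub) => /eqP /(fset_set_inj finD finAB) eD s [Us Vs].
  apply: contrapT => nWs; have : (A `|` B) s by left.
  by rewrite -eD => -[].
move=> UVW; suff eD : uset U `\` uset V = A `|` B by rewrite /cut_count eD.
apply/seteqP; split=> // s [[Us nWs]|[Ws nVs]]; split=> //.
  by move=> Vs; apply: nWs; apply: UVW.
(* Were [s] not in [U], its flip would be in both [U] and [V], hence in [W] together with [s]. *)
apply: (uset_flipN (uset_sub Ws)) => Ufs; apply: (uset_flip Ws); apply: UVW.
by split=> //; apply: usetN => //; apply: uset_sub Ws.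
Qed.

(** Minimality keeps the new family upward closed: no other member of [U] lies below [s], and if [r]
    is above [flip s] with [flip r] in [U], then [flip r] lies below [s], so [r = flip s]. *)
Lemma flip_minimal U s :
  uset U s -> (forall t, uset U t -> sep_le t s -> t = s) ->
  exists U', uset U' = (uset U `\ s) `|` [set flip s].
Proof.
move=> Us smin; have Ss := uset_sub Us.
have Sfs := SS.2 _ Ss.
pose N := (uset U `\ s) `|` [set flip s].
have nsf : s <> flip s.
  by move=> e; apply: (separation_systemN_le_flip SS Ss); rewrite -e; apply: sep_le_refl.
have uN : ultrafilter Sigma N.
  split.
  - by move=> t [[/uset_sub]|->].
  - move=> t St; split.
      have [->|ts] := pselect (t = s); first by right; right.
      have [->|tfs] := pselect (t = flip s); first by left; right.
      have [Ut|Uft] := uset_or U St; first by left; left.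
      by right; left; split=> // e; apply: tfs; rewrite -e flipK.
    move=> [[[Ut ts]|->] [[Uft fts]|efs]].
    + exact: uset_flip Uft.
    + by apply: ts; rewrite /= -[t]flipK efs flipK.
    + by apply: fts; rewrite /= flipK.
    + by apply: nsf; rewrite -efs flipK.
  - move=> t r [[Ut ts]|->] Sr tr.
      left; split; first exact: uset_up tr.
      by move=> e; apply: ts; apply: smin => //; rewrite -e.
    have [->|rfs] := pselect (r = flip s); first by right.
    left; split; last first.
      by move=> e; apply: (separation_systemN_flip_le SS Ss); rewrite -{2}e.
    apply: (uset_flipN Sr) => Ufr; apply: rfs.
    by rewrite -(smin _ Ufr) ?flipK //; apply: sep_le_flipl.
have dN : DCC N.
  move=> [f [Nf df]].
  have shift k : ~ (forall n, uset U (f (n + k)%N)).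
    by move=> Uf; apply: (@uset_DCC U); exists (fun n => f (n + k)%N); split=> // n; apply: df.
  (* A strictly descending chain meets [flip s] at most once, so the terms after index [k] form a
     chain in [U]. *)
  have [[k fk]|nk] := pselect (exists k, f k = flip s); last first.
    apply: (shift 0%N) => n; rewrite addn0.
    by case: (Nf n) => [[]//|fn]; case: nk; exists n.
  apply: (shift k.+1) => n; case: (Nf (n + k.+1)%N) => [[]//|/= e].
  have := descending_inj df (etrans e (esym fk)).
  by rewrite addnS => /eqP; rewrite gtn_eqF // ltnS leq_addl.
by exists (exist _ N (conj uN dN)).
Qed.

Lemma exists_walk_cut_count U V : exists2 p, walk U V p & size p = cut_count U V.
Proof.
have [n] := ubnP (cut_count U V); elim: n U => // n IH U ltn.
have [eUV|[s Ds]] : U = V \/ exists s, (uset U `\` uset V) s.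
  have [ex|nex] := pselect (exists s, (uset U `\` uset V) s); first by right.
  left; apply: uset_sub_eq => s Us; apply: contrapT => nVs.
  by apply: nex; exists s.
  by exists [::] => //; rewrite eUV /cut_count setDv fset_set0 cardfs0.
have [|m [Dm _ mmin]] := @DCC_min _ (uset U `\` uset V) s _ Ds.
  by apply: DCC_sub (@uset_DCC U) => t [].
(* The minimal element [m] of the difference is minimal in all of [U]: a member of [U] below [m]
   cannot lie in [V], since [V] would then contain [m]. *)
have [|U' eU'] := @flip_minimal U m Dm.1.
  move=> t Ut tm; apply: mmin => //; split=> // Vt; apply: Dm.2.
  by apply: uset_up Vt _ tm; apply: uset_sub Dm.1.
have [Vfm nUfm] := flip_setD Dm.
have eD : uset U' `\` uset V = (uset U `\` uset V) `\ m.
  rewrite eU'; apply/seteqP; split=> t.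
    by move=> [[[Ut tm]|->] nVt].
  by move=> [[Ut nVt] tm]; split=> //; left.
have eC : cut_count U V = (cut_count U' V).+1 by rewrite (cut_countS Dm) -eD.
have [|p [pp lp] sp] := IH U'; first by rewrite -ltnS -eC.
exists (U' :: p); last by rewrite /= sp eC.
split=> //=; rewrite -[path _ _ _]/(path (@adj M) U' p) pp andbT.
apply/dual_adjP; exists m; rewrite eU'; apply/seteqP; split=> t.
  move=> [Ut nt]; apply: contrapT => ntm; apply: nt.
  by left.
move=> ->; split; first exact: Dm.1.
by move=> [[_]|e]; [apply | apply: nUfm; rewrite -e; exact: Dm.1].
Qed.

(** By the triangle inequality each edge of the walk accounts for at most one separation. *)
Lemma walk_cut_count U V p : walk U V p -> (cut_count U V <= size p)%N.
Proof.
elim: p U => [|W p IH] U [/= pp lp].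
  by rewrite lp /cut_count setDv fset_set0 cardfs0.
have /andP [UW pW] : @adj M U W && path (@adj M) W p := pp.
have [s eUW] : exists s, uset U `\` uset W = [set s] by apply/dual_adjP.
apply: leq_trans (cut_count_triangle U W V) _.
by rewrite /cut_count {1}eUW fset_set1 cardfs1 add1n ltnS; apply: IH.
Qed.

Lemma geodesicP U V p : geodesic U V p <-> walk U V p /\ size p = cut_count U V.
Proof.
split=> [[wp pmin]|[wp sp]]; last first.
  by split=> // q /walk_cut_count; rewrite sp.
split=> //; apply/eqP; rewrite eqn_leq walk_cut_count // andbT.
by have [q wq <-] := exists_walk_cut_count U V; apply: pmin.
Qed.

Lemma geodesic_setI U V W p :
  geodesic U V p -> List.In W (U :: p) -> uset U `&` uset V `<=` uset W.
Proof.
move=> /geodesicP [wp sp] Wp; apply/cut_count_add.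
have [p1 [p2 [ep w1 w2]]] := walk_split wp Wp.
rewrite eqn_leq cut_count_triangle -sp ep size_cat.
by apply: leq_add; apply: walk_cut_count.
Qed.

Lemma intervalP U V W : interval U V W <-> uset U `&` uset V `<=` uset W.
Proof.
split=> [[p gp Wp]|/cut_count_add /eqP eC]; first exact: geodesic_setI gp Wp.
have [p1 [pp1 lp1] s1] := exists_walk_cut_count U W.
have [p2 [pp2 lp2] s2] := exists_walk_cut_count W V.
exists (p1 ++ p2).
  apply/geodesicP; split; last by rewrite size_cat s1 s2 eC.
  by split; [rewrite cat_path pp1 lp1 | rewrite last_cat lp1].
rewrite -lp1; elim: (p1) (U) => [|a q IH] b /=; first by left.
by right; apply: IH.
Qed.

(** * Medians of ultrafilters and convexity of the vertex preimages *)

Lemma majority U V W : exists X,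
  uset X = (uset U `&` uset V) `|` (uset V `&` uset W) `|` (uset W `&` uset U).
Proof.
pose N := (uset U `&` uset V) `|` (uset V `&` uset W) `|` (uset W `&` uset U).
have uN : ultrafilter Sigma N.
  split.
  - by move=> s [[[/uset_sub]|[/uset_sub]]|[/uset_sub]].
  - move=> s Ss; split.
      have [] := uset_or U Ss; have [] := uset_or V Ss; have [] := uset_or W Ss;
        move=> w v u; first [by left; left; left | by left; left; right | by left; right
          | by right; left; left | by right; left; right | by right; right].
    have nU := @uset_flip U s; have nV := @uset_flip V s; have nW := @uset_flip W s.
    by move=> [[[[? ?]|[? ?]]|[? ?]] [[[? ?]|[? ?]]|[? ?]]];
      first [exact: nU | exact: nV | exact: nW].
  - move=> s t Ns St st.
    have up X : uset X s -> uset X t by move=> Xs; apply: uset_up st.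
    by case: Ns => [[[/up ? /up ?]|[/up ? /up ?]]|[/up ? /up ?]];
      first [by left; left | by left; right | by right].
have dN : DCC N.
  move=> [f [Nf df]].
  (* By upward closure a descending chain that has left an ultrafilter never returns. Once out of
     both [U] and [V] it is out of [N], each of whose members lies in [U] or [V]. *)
  have leaves X : exists k, forall n, (k <= n)%N -> ~ uset X (f n).
    apply: contrapT => nX; apply: (@uset_DCC X); exists f; split=> // n.
    apply: contrapT => nXn; apply: nX; exists n => m nm Xm; apply: nXn.
    apply: uset_up Xm _ (descending_le df nm).
    by case: (Nf n) => [[[/uset_sub]|[/uset_sub]]|[/uset_sub]].
  have [k kU] := leaves U; have [l lV] := leaves V.
  have nU := kU _ (leq_maxl k l); have nV := lV _ (leq_maxr k l).
  by case: (Nf (maxn k l)) => [[[]|[]]|[]].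
by exists (exist _ N (conj uN dN)).
Qed.

Lemma dual_median_graph : median_graph M.
Proof.
split; first split.
- by have [U uU] := exists_dcc_ultrafilter SS dS cS; exists (exist _ U uU).
- by move=> U V; have [p wp _] := exists_walk_cut_count U V; exists p.
- move=> U V W; have [X eX] := majority U V W; exists X.
  apply/seteqP; split=> [Y [[/intervalP UV /intervalP VW] /intervalP WU]|Y ->].
    (* Uniqueness: a point of all three intervals contains the majority, and inclusion of
       ultrafilters is equality. *)
    apply/esym/uset_sub_eq; rewrite eX.
    by move=> s [[]|]; [apply: UV | apply: VW | apply: WU].
  split; first split; apply/intervalP => s Is; rewrite eX.
  + by left; left.
  + by left; right.
  + by right.
Qed.

(** A separation of [W] missing from both ends of the geodesic would have its flip in both, hence in
    [W]; so it belongs to an end, whose part contains [v]. *)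
Lemma dual_part_convex (v : G) : induces_convex [set U : M | dual_part U v].
Proof.
move=> U V p Uv Vv gp W Wp s Ws.
have UVW := geodesic_setI gp Wp.
have Ss := uset_sub Ws.
have [Us|nUs] := pselect (uset U s); first exact: Uv.
have [Vs|nVs] := pselect (uset V s); first exact: Vv.
by case: (uset_flip Ws); apply: UVW; split; apply: usetN.
Qed.

End DualGraph.

Theorem theorem6p3 (G : sgraph) (Sigma : set (sep G)) :
  separation_system Sigma -> discrete Sigma -> crossing_finite Sigma ->
  ECC Sigma ->
  median_decomposition (M := dual_graph Sigma) (@dual_part G Sigma).
Proof.
move=> SS dS cS ecc; split.
- exact: dual_median_graph.
- apply/seteqP; split=> // x _.
  (* (M1) is the degenerate case in which both vertices are [x]. *)
  have [|U [Ux _]] := @exists_dcc_ultrafilter_containing G Sigma x x SS dS cS ecc.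
    move=> s /SS.1 [[s12 _] _]; have : (s.1 `|` s.2) x by rewrite s12.
    by case; [left | right].
  by exists U.
- move=> x y xy; apply: exists_dcc_ultrafilter_containing => // s /SS.1 [[s12 sN] _].
  have cov z : s.1 z \/ s.2 z by have : (s.1 `|` s.2) z by rewrite s12.
  apply: contrapT => nside.
  (* If no side held both ends, the edge would join the two strict sides of [s]. *)
  have [x1|nx1] := pselect (s.1 x); have [y1|ny1] := pselect (s.1 y).
  + by apply: nside; left.
  + have y2 : s.2 y by case: (cov y).
    have x2 : ~ s.2 x by move=> x2; apply: nside; right.
    by have := sN x y (conj x1 x2) (conj y2 ny1); rewrite xy.
  + have x2 : s.2 x by case: (cov x).
    have y2 : ~ s.2 y by move=> y2; apply: nside; right.
    by have := sN y x (conj y1 y2) (conj x2 nx1); rewrite adj_sym xy.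
  + by apply: nside; right; split; [case: (cov x) | case: (cov y)].
- exact: dual_part_convex.
Qed.
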